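(* Let $(B,\mu,u,\Delta,\varepsilon)$ be a bialgebra over a field $\Bbbk$. Every right Hopf partial comodule over $B$ is globalizable as a geometric partial comodule over the coalgebra $(B,\Delta,\varepsilon)$ in the monoidal category $\mathsf{Mod}_B$ of right $B$-modules.
   Context: $\mathsf{Mod}_B$ is monoidal with $\otimes=\otimes_\Bbbk$ (diagonal action $(m\otimes n)\cdot b=m\cdot b_{(1)}\otimes n\cdot b_{(2)}$) and unit $\Bbbk$ (action via $\varepsilon$); $B$ with its regular right module structure is a coalgebra in $\mathsf{Mod}_B$, and its (global) comodules in $\mathsf{Mod}_B$ are the right Hopf modules over $B$. A right Hopf partial comodule over $B$ is a geometric partial comodule $(M,M\bullet B,\pi_M,\rho_M)$ over $(B,\Delta,\varepsilon)$ in $\mathcal C=\mathsf{Mod}_B$, i.e.: $M$ and $M\bullet B$ are right $B$-modules, $\rho_M:M\to M\bullet B$ is $B$-linear, $\pi_M:M\otimes B\to M\bullet B$ is a $B$-linear surjection, and the following hold. Let $(M\bullet B)\bullet B$, with maps $\rho_M\bullet B:M\bullet B\to(M\bullet B)\bullet B$ and $\pi_{M\bullet B}:(M\bullet B)\otimes B\to(M\bullet B)\bullet B$, be the pushout in $\mathcal C$ of $\pi_M$ and $\rho_M\otimes B$; let $M\bullet(B\bullet B)$, with maps $M\bullet\Delta:M\bullet B\to M\bullet(B\bullet B)$ and $\pi_{M,\Delta}:(M\bullet B)\otimes B\to M\bullet(B\bullet B)$, be the pushout in $\mathcal C$ of $\pi_M$ and $(\pi_M\otimes B)\circ(M\otimes\Delta)$.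 (GPC1) There is $M\bullet\varepsilon:M\bullet B\to M$ with $(M\bullet\varepsilon)\circ\rho_M=\mathrm{Id}_M$ and $(M\bullet\varepsilon)\circ\pi_M=M\otimes\varepsilon$. (GPC2) There is an isomorphism $\theta:M\bullet(B\bullet B)\to(M\bullet B)\bullet B$ with $\theta\circ\pi_{M,\Delta}=\pi_{M\bullet B}$ and $\theta\circ(M\bullet\Delta)\circ\rho_M=(\rho_M\bullet B)\circ\rho_M$. It is globalizable if there are a right Hopf module $(Y,\delta)$ over $B$ and a $B$-linear map $p:Y\to M$ such that: (GL1) $\rho_M\circ p=\pi_M\circ(p\otimes B)\circ\delta$; (GL2) for every right Hopf module $(Z,\delta_Z)$, $\eta\mapsto p\circ\eta$ is a bijection from Hopf module morphisms $Z\to Y$ onto $B$-linear maps $f:Z\to M$ with $\rho_M\circ f=\pi_M\circ(f\otimes B)\circ\delta_Z$; (GL3) $(M\bullet B,\rho_M,\pi_M)$ is the pushout in $\mathsf{Mod}_B$ of $p:Y\to M$ and $(p\otimes B)\circ\delta:Y\to M\otimes B$. *)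

(* Defs.v *)
(* MathComp, with the classical axioms of mathcomp.classical.boolp. *)
From HB Require Import structures.
From mathcomp Require Import all_boot all_order all_algebra.
From mathcomp Require Import boolp.

Set Implicit Arguments.
Unset Strict Implicit.
Unset Printing Implicit Defensive.

Import GRing.Theory.
Local Open Scope ring_scope.
Local Open Scope quotient_scope.

Notation bilin f := (bilinear_for *:%R *:%R f).

(* The tensor product V (x) W over k of arbitrary (possibly infinite-          *)
(* dimensional) vector spaces. A formal sum \sum_i v_i (x) w_i is a sequence   *)
(* of pairs, scalars being absorbed in the left factor; two formal sums denote *)
(* the same tensor iff every bilinear map out of V x W takes the same value on *)
(* them. The universal property is tlift_pure together with tlift_unique.      *)
Section Tensor.
Context (k : fieldType).
Implicit Types U V W T : lmodType k.

Definition fsum V W T (f : V -> W -> T) (s : seq (V * W)) : T :=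
  \sum_(p <- s) f p.1 p.2.

Definition teqv V W (s t : seq (V * W)) : bool :=
  `[< forall (T : lmodType k) (f : V -> W -> T), bilin f -> fsum f s = fsum f t >].

Lemma teqvP V W (s t : seq (V * W)) :
  reflect (forall T (f : V -> W -> T), bilin f -> fsum f s = fsum f t)
          (teqv s t).
Proof. exact: asboolP. Qed.

Lemma teqv_refl V W : reflexive (@teqv V W).
Proof. by move=> s; apply/teqvP. Qed.

Lemma teqv_sym V W : symmetric (@teqv V W).
Proof.
by move=> s t; apply/teqvP/teqvP => h T f fP; rewrite h.
Qed.

Lemma teqv_trans V W : transitive (@teqv V W).
Proof.
by move=> t s u /teqvP h1 /teqvP h2; apply/teqvP => T f fP; rewrite h1// h2.
Qed.

Canonical teqv_equiv V W :=
  EquivRel (@teqv V W) (@teqv_refl V W) (@teqv_sym V W) (@teqv_trans V W).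

Definition tens V W := {eq_quot (teqv_equiv V W)}.

HB.instance Definition _ V W := Choice.on (tens V W).

Definition tens_of V W (s : seq (V * W)) : tens V W := \pi_({eq_quot (teqv_equiv V W)}) s.

Definition tpure V W (v : V) (w : W) : tens V W := tens_of [:: (v, w)].

Definition tens_repr V W (t : tens V W) : seq (V * W) :=
  repr (t : {eq_quot (teqv_equiv V W)}).

(* For bilinear f the value does not depend on the representative: tlift_of.   *)
Definition tlift V W T (f : V -> W -> T) (t : tens V W) : T :=
  fsum f (tens_repr t).

Lemma tens_of_eq V W (s t : seq (V * W)) :
  (forall T (f : V -> W -> T), bilin f -> fsum f s = fsum f t) ->
  tens_of s = tens_of t.
Proof. by move=> h; apply/eqquotP/teqvP. Qed.

Lemma tens_of_repr V W (t : tens V W) : tens_of (tens_repr t) = t.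
Proof. exact: reprK. Qed.

Lemma tlift_of V W T (f : V -> W -> T) s :
  bilin f -> tlift f (tens_of s) = fsum f s.
Proof.
move=> fP; rewrite /tlift.
suff /teqvP/(_ _ _ fP) : teqv (tens_repr (tens_of s)) s by [].
by apply/eqquotP; exact: reprK.
Qed.

Lemma tens_ext V W (x y : tens V W) :
  (forall T (f : V -> W -> T), bilin f -> tlift f x = tlift f y) -> x = y.
Proof.
move=> h; rewrite -[x]tens_of_repr -[y]tens_of_repr.
by apply: tens_of_eq => T f fP; have := h T f fP.
Qed.

Definition tzero V W : tens V W := tens_of [::].
Definition tadd V W (x y : tens V W) : tens V W :=
  tens_of (tens_repr x ++ tens_repr y).
Definition tscale V W (c : k) (x : tens V W) : tens V W :=
  tens_of [seq (c *: p.1, p.2) | p <- tens_repr x].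
Definition topp V W (x : tens V W) : tens V W := tscale (-1) x.

Lemma tlift0' V W T (f : V -> W -> T) : bilin f -> tlift f (tzero V W) = 0.
Proof. by move=> fP; rewrite tlift_of// /fsum big_nil. Qed.

Lemma tliftD' V W T (f : V -> W -> T) x y :
  bilin f -> tlift f (tadd x y) = tlift f x + tlift f y.
Proof. by move=> fP; rewrite tlift_of// /fsum big_cat. Qed.

Lemma bilinZl V W T (f : V -> W -> T) c v w :
  bilin f -> f (c *: v) w = c *: f v w.
Proof.
by move=> fP; have /= := scalable_linear (fP.1 w) c v.
Qed.

Lemma bilinZr V W T (f : V -> W -> T) c v w :
  bilin f -> f v (c *: w) = c *: f v w.
Proof.
by move=> fP; have /= := scalable_linear (fP.2 v) c w.
Qed.

Lemma tliftZ' V W T (f : V -> W -> T) c x :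
  bilin f -> tlift f (tscale c x) = c *: tlift f x.
Proof.
move=> fP; rewrite tlift_of// /fsum big_map /tlift /fsum scaler_sumr.
by apply: eq_bigr => p _; rewrite bilinZl.
Qed.

Lemma taddA V W : associative (@tadd V W).
Proof. by move=> x y z; apply: tens_ext => T f fP; rewrite !tliftD'// addrA. Qed.
Lemma taddC V W : commutative (@tadd V W).
Proof. by move=> x y; apply: tens_ext => T f fP; rewrite !tliftD'// addrC. Qed.
Lemma tadd0 V W : left_id (tzero V W) (@tadd V W).
Proof.
by move=> x; apply: tens_ext => T f fP; rewrite tliftD'// tlift0'// add0r.
Qed.
Lemma taddN V W : left_inverse (tzero V W) (@topp V W) (@tadd V W).
Proof.
move=> x; apply: tens_ext => T f fP.
by rewrite tliftD'// tlift0'// tliftZ'// scaleN1r addNr.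
Qed.

HB.instance Definition _ V W := GRing.isZmodule.Build (tens V W)
  (@taddA V W) (@taddC V W) (@tadd0 V W) (@taddN V W).

Lemma tscaleA V W c d (x : tens V W) : tscale c (tscale d x) = tscale (c * d) x.
Proof. by apply: tens_ext => T f fP; rewrite !tliftZ'// scalerA. Qed.
Lemma tscale1 V W : left_id 1 (@tscale V W).
Proof. by move=> x; apply: tens_ext => T f fP; rewrite !tliftZ'// scale1r. Qed.
Lemma tscaleDr V W : right_distributive (@tscale V W) +%R.
Proof.
move=> c x y; apply: tens_ext => T f fP.
by rewrite !(tliftZ', tliftD')// scalerDr.
Qed.
Lemma tscaleDl V W (x : tens V W) : {morph (@tscale V W)^~ x : c d / c + d}.
Proof.
move=> c d; apply: tens_ext => T f fP.
by rewrite !(tliftZ', tliftD')// scalerDl.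
Qed.

HB.instance Definition _ V W := GRing.Zmodule_isLmodule.Build k (tens V W)
  (@tscaleA V W) (@tscale1 V W) (@tscaleDr V W) (@tscaleDl V W).

Lemma tlift_linear V W T (f : V -> W -> T) : bilin f -> linear (tlift f).
Proof. by move=> fP c x y; rewrite tliftD'// tliftZ'. Qed.

Lemma tlift_pure V W T (f : V -> W -> T) v w :
  bilin f -> tlift f (tpure v w) = f v w.
Proof. by move=> fP; rewrite tlift_of// /fsum big_seq1. Qed.

Lemma tpure_bilin V W : bilin (@tpure V W).
Proof.
split=> [w c v v'|v c w w']; apply: tens_ext => T f fP.
  by rewrite (tlift_linear fP) !tlift_pure//; exact: fP.1.
by rewrite (tlift_linear fP) !tlift_pure//; exact: fP.2.
Qed.

Lemma tens_sum V W (t : tens V W) : t = \sum_(p <- tens_repr t) tpure p.1 p.2.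
Proof.
apply: tens_ext => T f fP.
transitivity (\sum_(p <- tens_repr t) tlift f (tpure p.1 p.2)).
  by apply: eq_bigr => p _; rewrite tlift_pure.
elim: (tens_repr t) => [|p s IH]; first by rewrite !big_nil tlift0'.
by rewrite !big_cons IH tliftD'.
Qed.

Lemma tlift_unique V W T (g h : tens V W -> T) :
  linear g -> linear h -> (forall v w, g (tpure v w) = h (tpure v w)) ->
  g =1 h.
Proof.
move=> gP hP gh t; rewrite [t]tens_sum.
pose G : {linear tens V W -> T} :=
  HB.pack g (GRing.isLinear.Build _ _ _ _ g gP).
pose H : {linear tens V W -> T} :=
  HB.pack h (GRing.isLinear.Build _ _ _ _ h hP).
rewrite -[g]/(G : _ -> _) -[h]/(H : _ -> _) !raddf_sum.
by apply: eq_bigr => p _; exact: gh.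
Qed.

Lemma tliftE V W T (f : V -> W -> T) t :
  tlift f t = \sum_(p <- tens_repr t) f p.1 p.2.
Proof. by []. Qed.

Lemma tliftPf V W T (f g h : V -> W -> T) c t :
  (forall v w, f v w = c *: g v w + h v w) ->
  tlift f t = c *: tlift g t + tlift h t.
Proof.
move=> E; rewrite !tliftE scaler_sumr -big_split /=.
by apply: eq_bigr => p _; rewrite E.
Qed.

Lemma eq_tlift V W T (f g : V -> W -> T) t :
  (forall v w, f v w = g v w) -> tlift f t = tlift g t.
Proof. by move=> E; apply: eq_bigr => p _; rewrite E. Qed.

Lemma linear_bilin V W T T' (g : {linear T -> T'}) (f : V -> W -> T) :
  bilin f -> bilin (fun v w => g (f v w)).
Proof.
move=> fP; split=> [w c v v'|v c w w'] /=.
  by rewrite -linearP; congr (g _); exact: fP.1.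
by rewrite -linearP; congr (g _); exact: fP.2.
Qed.

End Tensor.

Section TensorMaps.
Context (k : fieldType).
Implicit Types U V W T : lmodType k.

(* f (x) g *)
Definition tmap V V' W W' (f : {linear V -> V'}) (g : {linear W -> W'}) :
    tens V W -> tens V' W' :=
  tlift (fun v w => tpure (f v) (g w)).

Lemma tmap_bilin V V' W W' (f : {linear V -> V'}) (g : {linear W -> W'}) :
  bilin (fun v w => tpure (f v) (g w)).
Proof.
split=> [w c v v'|v c w w'] /=; rewrite linearP.
  exact: (tpure_bilin _ _).1.
exact: (tpure_bilin _ _).2.
Qed.

HB.instance Definition _ V V' W W' f g :=
  GRing.isLinear.Build _ _ _ _ (@tmap V V' W W' f g)
    (tlift_linear (tmap_bilin f g)).

Lemma tmap_pure V V' W W' (f : {linear V -> V'}) (g : {linear W -> W'}) v w :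
  tmap f g (tpure v w) = tpure (f v) (g w).
Proof. exact/tlift_pure/tmap_bilin. Qed.

(* (u (x) v) (x) w |-> u (x) (v (x) w) *)
Definition tassoc U V W : tens (tens U V) W -> tens U (tens V W) :=
  tlift (fun x w => tlift (fun u v => tpure u (tpure v w)) x).

Lemma tassoc_bilin1 U V W (w : W) :
  bilin (fun (u : U) (v : V) => tpure u (tpure v w)).
Proof.
split=> [v c u u'|u c v v'] /=; first exact: (tpure_bilin _ _).1.
rewrite -(tpure_bilin _ _).2; congr tpure; exact: (tpure_bilin _ _).1.
Qed.

Lemma tassoc_bilin U V W : bilin (fun (x : tens U V) (w : W) =>
  tlift (fun u v => tpure u (tpure v w)) x).
Proof.
split=> [w c x x'|x c w w'] /=; first exact/tlift_linear/tassoc_bilin1.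
apply: tliftPf => u v.
rewrite -(tpure_bilin _ _).2; congr tpure; exact: (tpure_bilin _ _).2.
Qed.

HB.instance Definition _ U V W :=
  GRing.isLinear.Build _ _ _ _ (@tassoc U V W)
    (tlift_linear (tassoc_bilin U V W)).

Lemma tassoc_pure U V W (u : U) (v : V) (w : W) :
  tassoc (tpure (tpure u v) w) = tpure u (tpure v w).
Proof.
by rewrite /tassoc tlift_pure ?tlift_pure//;
  [exact: tassoc_bilin1|exact: tassoc_bilin].
Qed.

(* u (x) (v (x) w) |-> (u (x) v) (x) w *)
Definition tassocV U V W : tens U (tens V W) -> tens (tens U V) W :=
  tlift (fun u y => tlift (fun v w => tpure (tpure u v) w) y).

Lemma tassocV_bilin1 U V W (u : U) :
  bilin (fun (v : V) (w : W) => tpure (tpure u v) w).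
Proof.
split=> [w c v v'|v c w w'] /=; last exact: (tpure_bilin _ _).2.
rewrite -[RHS](tpure_bilin _ _).1 /=; congr tpure; exact: (tpure_bilin _ _).2.
Qed.

Lemma tassocV_bilin U V W : bilin (fun (u : U) (y : tens V W) =>
  tlift (fun v w => tpure (tpure u v) w) y).
Proof.
split=> [y c u u'|u c y y'] /=; last exact/tlift_linear/tassocV_bilin1.
apply: tliftPf => v w.
rewrite -[RHS](tpure_bilin _ _).1 /=; congr tpure; exact: (tpure_bilin _ _).1.
Qed.

HB.instance Definition _ U V W :=
  GRing.isLinear.Build _ _ _ _ (@tassocV U V W)
    (tlift_linear (tassocV_bilin U V W)).

Lemma tassocV_pure U V W (u : U) (v : V) (w : W) :
  tassocV (tpure u (tpure v w)) = tpure (tpure u v) w.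
Proof.
by rewrite /tassocV tlift_pure ?tlift_pure//;
  [exact: tassocV_bilin1|exact: tassocV_bilin].
Qed.

(* v (x) c |-> c v and c (x) v |-> c v *)
Definition trunit V : tens V k^o -> V := tlift (fun (v : V) (c : k^o) => c *: v).
Definition tlunit V : tens k^o V -> V := tlift (fun (c : k^o) (v : V) => c *: v).

Lemma trunit_bilin V : bilin (fun (v : V) (c : k^o) => c *: v).
Proof.
split=> [c d v v'|v d c c'] /=.
  by rewrite scalerDr !scalerA mulrC.
by rewrite scalerDl scalerA.
Qed.

Lemma tlunit_bilin V : bilin (fun (c : k^o) (v : V) => c *: v).
Proof.
split=> [v d c c'|c d v v'] /=; first by rewrite scalerDl scalerA.
by rewrite scalerDr !scalerA mulrC.
Qed.

HB.instance Definition _ V :=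
  GRing.isLinear.Build _ _ _ _ (@trunit V) (tlift_linear (trunit_bilin V)).
HB.instance Definition _ V :=
  GRing.isLinear.Build _ _ _ _ (@tlunit V) (tlift_linear (tlunit_bilin V)).

Lemma trunit_pure V (v : V) (c : k^o) : @trunit V (@tpure k V k^o v c) = c *: v.
Proof. exact/tlift_pure/trunit_bilin. Qed.
Lemma tlunit_pure V (v : V) (c : k^o) : @tlunit V (@tpure k k^o V c v) = c *: v.
Proof. exact: (tlift_pure _ _ (tlunit_bilin V)). Qed.

(* If V is acted upon by A and W by A' (through arbitrary maps), this is       *)
(* (v (x) w) . (a (x) a') = v.a (x) w.a'.                                      *)
Definition tact (A A' : lmodType k) V W (f : V -> A -> V) (g : W -> A' -> W)
    (t : tens V W) (x : tens A A') : tens V W :=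
  tlift (fun v w => tlift (fun a a' => tpure (f v a) (g w a')) x) t.

Section Tact.
Context (A A' V W : lmodType k) (f : V -> A -> V) (g : W -> A' -> W).
Hypotheses (fP : bilin f) (gP : bilin g).

Lemma tact_bilin1 v w : bilin (fun a a' => tpure (f v a) (g w a')).
Proof.
split=> [a' c a b|a c a' b'] /=.
  by rewrite -[RHS](tpure_bilin _ _).1 /=; congr tpure; exact: fP.2.
by rewrite -(tpure_bilin _ _).2 /=; congr tpure; exact: gP.2.
Qed.

Lemma tact_bilin2 x :
  bilin (fun v w => tlift (fun a a' => tpure (f v a) (g w a')) x).
Proof.
split=> [w c v v'|v c w w'] /=; apply: tliftPf => a a'.
  by rewrite -[RHS](tpure_bilin _ _).1 /=; congr tpure; exact: fP.1.
by rewrite -(tpure_bilin _ _).2 /=; congr tpure; exact: gP.1.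
Qed.

Lemma tact_bilin : bilin (tact f g).
Proof.
split=> [x c t t'|t c x x'] /=; first exact/tlift_linear/tact_bilin2.
by apply: tliftPf => v w; exact/tlift_linear/tact_bilin1.
Qed.

Lemma tact_pure v w a a' :
  tact f g (tpure v w) (tpure a a') = tpure (f v a) (g w a').
Proof.
by rewrite /tact tlift_pure ?tlift_pure//;
  [exact: tact_bilin1|exact: tact_bilin2].
Qed.

End Tact.

End TensorMaps.

(* The product of the algebra A (x) A: (a (x) b)(a' (x) b') = aa' (x) bb'. *)
Definition tmul (k : fieldType) (A : algType k) :
    tens A A -> tens A A -> tens A A :=
  tact (fun a a' : A => a * a') (fun b b' : A => b * b').

Record bialgebra (k : fieldType) := Bialgebra {
  bialg :> algType k;
  comul : {linear bialg -> tens bialg bialg};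
  counit : {lrmorphism bialg -> k^o};
  comulA : forall b,
    tassoc (tmap comul idfun (comul b)) = tmap idfun comul (comul b);
  comul_counitl : forall b, tlunit (tmap counit idfun (comul b)) = b;
  comul_counitr : forall b, trunit (tmap idfun counit (comul b)) = b;
  comul1 : comul 1 = tpure 1 1;
  comulM : forall a b, comul (a * b) = tmul (comul a) (comul b)
}.

(* Objects and morphisms of Mod_B. *)
Record rmod (k : fieldType) (B : bialgebra k) := RMod {
  rcar :> lmodType k;
  ract : rcar -> B -> rcar;
  ract_bilin : bilin ract;
  ract1 : forall m, ract m 1 = m;
  ractM : forall m a b, ract m (a * b) = ract (ract m a) b
}.

Record rhom (k : fieldType) (B : bialgebra k) (M N : rmod B) := RHom {
  rfun :> {linear M -> N};
  rfun_act : forall m b, rfun (ract m b) = ract (rfun m) b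
}.

Section ModB.
Context (k : fieldType) (B : bialgebra k).
Implicit Types M N P : rmod B.

Lemma rid_act M (m : M) b : (idfun : {linear M -> M}) (ract m b) = ract m b.
Proof. by []. Qed.
Definition rid M : rhom M M := @RHom _ _ M M idfun (@rid_act M).

Lemma rcomp_act M N P (g : rhom N P) (f : rhom M N) m b :
  (g \o f) (ract m b) = ract ((g \o f) m) b.
Proof. by rewrite /= !rfun_act. Qed.
Definition rcomp M N P (g : rhom N P) (f : rhom M N) : rhom M P :=
  RHom (rcomp_act g f).

(* M (x) N with the diagonal action. *)
Definition diag_act M N (t : tens M N) (b : B) : tens M N :=
  tact (@ract _ _ M) (@ract _ _ N) t (comul B b).

Lemma tact_tmul M N (t : tens M N) (x y : tens B B) :
  tact (@ract _ _ M) (@ract _ _ N) t (tmul x y) =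
  tact (@ract _ _ M) (@ract _ _ N) (tact (@ract _ _ M) (@ract _ _ N) t x) y.
Proof.
have mulP : bilin (fun a b : B => a * b).
  split=> [b c a a'|a c b b'] /=; first by rewrite mulrDl scalerAl.
  by rewrite mulrDr scalerAr.
have tmulP : bilin (@tmul _ B) by exact: tact_bilin.
have aP := tact_bilin (ract_bilin M) (ract_bilin N).
move: y; apply: tlift_unique => [||a' b'].
- by move=> c y y'; rewrite [tmul _ _](tmulP.2) (aP.2).
- by move=> c y y'; rewrite (aP.2).
move: x; apply: tlift_unique => [||a b].
- by move=> c y y'; rewrite [tmul _ _](tmulP.1) (aP.2).
- by move=> c y y'; rewrite (aP.2) [LHS](aP.1).
move: t; apply: tlift_unique => [||m n].
- by move=> c y y'; rewrite [LHS](aP.1).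
- by move=> c y y'; rewrite [X in tact _ _ X _](aP.1) [LHS](aP.1).
rewrite [tmul _ _](tact_pure mulP mulP).
by rewrite !(tact_pure (ract_bilin M) (ract_bilin N)) !ractM.
Qed.

Lemma diag_act_bilin M N : bilin (@diag_act M N).
Proof.
have aP := tact_bilin (ract_bilin M) (ract_bilin N).
split=> [b c t t'|t c b b']; first exact: aP.1.
by rewrite /diag_act linearP (aP.2).
Qed.

Lemma diag_act1 M N (t : tens M N) : diag_act t 1 = t.
Proof.
have aP := tact_bilin (ract_bilin M) (ract_bilin N).
rewrite /diag_act comul1; move: t; apply: tlift_unique => //.
  by move=> c y y'; exact: aP.1.
by move=> m n; rewrite (tact_pure (ract_bilin M) (ract_bilin N)) !ract1.
Qed.

Lemma diag_actM M N (t : tens M N) a b :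
  diag_act t (a * b) = diag_act (diag_act t a) b.
Proof. by rewrite /diag_act comulM tact_tmul. Qed.

Definition rtens M N : rmod B :=
  RMod (diag_act_bilin M N) (@diag_act1 M N) (@diag_actM M N).

Lemma tmap_act M M' N N' (f : rhom M M') (g : rhom N N') t b :
  tmap f g (@diag_act M N t b) = @diag_act M' N' (tmap f g t) b.
Proof.
have aP := tact_bilin (ract_bilin M) (ract_bilin N).
have aP' := tact_bilin (ract_bilin M') (ract_bilin N').
rewrite /diag_act; move: (comul B b); apply: tlift_unique => [||b1 b2].
- by move=> c y y'; rewrite (aP.2) linearP.
- by move=> c y y'; rewrite (aP'.2).
move: t; apply: tlift_unique => [||m n].
- by move=> c y y'; rewrite [X in tmap _ _ X](aP.1) linearP.
- by move=> c y y'; rewrite linearP [LHS](aP'.1).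
rewrite tmap_pure (tact_pure (ract_bilin M) (ract_bilin N)).
by rewrite (tact_pure (ract_bilin M') (ract_bilin N')) tmap_pure !rfun_act.
Qed.

(* f (x) g in Mod_B *)
Definition rtmap M M' N N' (f : rhom M M') (g : rhom N N') :
    rhom (rtens M N) (rtens M' N') :=
  @RHom _ _ (rtens M N) (rtens M' N') (tmap f g) (tmap_act f g).

Lemma tassoc_act3 M N P (x : tens (tens B B) B) (t : tens (tens M N) P) :
  tassoc (tact (tact (@ract _ _ M) (@ract _ _ N)) (@ract _ _ P) t x) =
  tact (@ract _ _ M) (tact (@ract _ _ N) (@ract _ _ P)) (tassoc t) (tassoc x).
Proof.
have mP := ract_bilin M; have nP := ract_bilin N; have pP := ract_bilin P.
have mn := tact_bilin mP nP; have np := tact_bilin nP pP.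
have l := tact_bilin mn pP; have r := tact_bilin mP np.
move: x; apply: tlift_unique => [||y b3].
- by move=> c z z'; rewrite (l.2) linearP.
- by move=> c z z'; rewrite linearP (r.2).
move: y; apply: (@tlift_unique _ B B _ (fun y => _) (fun y => _)) => [||b1 b2].
- move=> c z z'.
  by rewrite [tpure _ _](tpure_bilin _ _).1 (l.2) linearP.
- move=> c z z'.
  by rewrite [tpure _ _](tpure_bilin _ _).1 linearP (r.2).
move: t; apply: tlift_unique => [||s p].
- by move=> c z z'; rewrite [X in tassoc X](l.1) linearP.
- by move=> c z z'; rewrite linearP [LHS](r.1).
move: s; apply: (@tlift_unique _ M N _ (fun y => _) (fun y => _)) => [||m n].
- move=> c z z'.
  by rewrite [tpure (_ + _) _](tpure_bilin _ _).1 [X in tassoc X](l.1) linearP.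
- move=> c z z'.
  by rewrite [tpure (_ + _) _](tpure_bilin _ _).1 linearP [LHS](r.1).
rewrite !tassoc_pure (tact_pure mn pP) (tact_pure mP nP) tassoc_pure.
by rewrite (tact_pure mP np) (tact_pure nP pP).
Qed.

Lemma tassoc_act M N P t b :
  tassoc (@diag_act (rtens M N) P t b) = @diag_act M (rtens N P) (tassoc t) b.
Proof.
have mP := ract_bilin M; have nP := ract_bilin N; have pP := ract_bilin P.
have mn := tact_bilin mP nP; have np := tact_bilin nP pP.
have E1 : @diag_act (rtens M N) P t b =
    tact (tact (@ract _ _ M) (@ract _ _ N)) (@ract _ _ P) t
      (tmap (comul B) idfun (comul B b)).
  have l := tact_bilin mn pP.
  have l' := tact_bilin (diag_act_bilin M N) pP.
  rewrite /diag_act /=; move: (comul B b); apply: tlift_unique => [||b1 b2].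
  - by move=> c z z'; rewrite (l'.2).
  - by move=> c z z'; rewrite linearP (l.2).
  rewrite tmap_pure; apply: eq_tlift => u p.
  rewrite tlift_pure; first by rewrite tlift_pure//; exact: tact_bilin1.
  exact: (tact_bilin1 (diag_act_bilin M N) pP).
have E2 s : @diag_act M (rtens N P) s b =
    tact (@ract _ _ M) (tact (@ract _ _ N) (@ract _ _ P)) s
      (tmap idfun (comul B) (comul B b)).
  have r := tact_bilin mP np.
  have r' := tact_bilin mP (diag_act_bilin N P).
  rewrite /diag_act /=; move: (comul B b); apply: tlift_unique => [||b1 b2].
  - by move=> c z z'; rewrite (r'.2).
  - by move=> c z z'; rewrite linearP (r.2).
  rewrite tmap_pure; apply: eq_tlift => m u.
  rewrite tlift_pure; first by rewrite tlift_pure//; exact: tact_bilin1.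
  exact: (tact_bilin1 mP (diag_act_bilin N P)).
by rewrite E1 tassoc_act3 comulA E2.
Qed.

Lemma tassocK U V W : cancel (@tassoc k U V W) (@tassocV k U V W).
Proof.
apply: tlift_unique => [||x w]; [by move=> c y z; rewrite !linearP|by []|].
move: x; apply: (@tlift_unique _ U V _ (fun y => _) (fun y => _)) => [||u v].
- by move=> c y z; rewrite [tpure _ _](tpure_bilin _ _).1 !linearP.
- by move=> c y z; rewrite [LHS](tpure_bilin _ _).1.
by rewrite tassoc_pure tassocV_pure.
Qed.

Lemma tassocVK U V W : cancel (@tassocV k U V W) (@tassoc k U V W).
Proof.
apply: tlift_unique => [||u y]; [by move=> c x z; rewrite !linearP|by []|].
move: y; apply: (@tlift_unique _ V W _ (fun y => _) (fun y => _)) => [||v w].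
- by move=> c x z; rewrite (tpure_bilin _ _).2 !linearP.
- by move=> c x z; rewrite (tpure_bilin _ _).2.
by rewrite tassocV_pure tassoc_pure.
Qed.

Lemma tassocV_act M N P t b :
  tassocV (@diag_act M (rtens N P) t b) = @diag_act (rtens M N) P (tassocV t) b.
Proof. by rewrite -{1}[t](@tassocVK M N P) -tassoc_act tassocK. Qed.

Definition rassoc M N P : rhom (rtens (rtens M N) P) (rtens M (rtens N P)) :=
  @RHom _ _ (rtens (rtens M N) P) (rtens M (rtens N P)) (@tassoc _ M N P)
    (@tassoc_act M N P).
Definition rassocV M N P : rhom (rtens M (rtens N P)) (rtens (rtens M N) P) :=
  @RHom _ _ (rtens M (rtens N P)) (rtens (rtens M N) P) (@tassocV _ M N P)
    (@tassocV_act M N P).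

(* The unit object: k acted upon through the counit. *)
Definition unit_act (c : k^o) (b : B) : k^o := c * counit B b.

Lemma unit_act_bilin : bilin unit_act.
Proof.
split=> [b c d d'|d c b b'] /=; first by rewrite /unit_act mulrDl -scalerAl.
by rewrite /unit_act linearP mulrDr -scalerAr.
Qed.
Lemma unit_act1 c : unit_act c 1 = c.
Proof. by rewrite /unit_act rmorph1 mulr1. Qed.
Lemma unit_actM c a b : unit_act c (a * b) = unit_act (unit_act c a) b.
Proof. by rewrite /unit_act rmorphM mulrA. Qed.

Definition runit : rmod B := RMod unit_act_bilin unit_act1 unit_actM.

Lemma trunit_act M t b : trunit (@diag_act M runit t b) = ract (trunit t) b.
Proof.
have mP := ract_bilin M.
have l := tact_bilin mP unit_act_bilin.
have E x : trunit (tact (@ract _ _ M) unit_act t x) =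
    ract (trunit t) (trunit (tmap idfun (counit B) x)).
  move: x; apply: tlift_unique => [||b1 b2].
  - by move=> c y y'; rewrite (l.2) linearP.
  - by move=> c y y'; rewrite !linearP (mP.2).
  move: t; apply: tlift_unique => [||m d].
  - by move=> c y y'; rewrite [X in trunit X](l.1) linearP.
  - by move=> c y y'; rewrite linearP [LHS](mP.1).
  rewrite (tact_pure mP unit_act_bilin) tmap_pure !trunit_pure.
  by rewrite (bilinZl _ _ _ mP) (bilinZr _ _ _ mP) scalerA.
by rewrite /diag_act E comul_counitr.
Qed.

(* The right unit constraint M (x) k -> M. *)
Definition rrunit M : rhom (rtens M runit) M :=
  @RHom _ _ (rtens M runit) M (@trunit _ M) (@trunit_act M).

(* B with its regular right module structure, a coalgebra in Mod_B. *)
Lemma reg_bilin : bilin (fun a b : B => a * b).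
Proof.
split=> [b c a a'|a c b b'] /=; first by rewrite mulrDl scalerAl.
by rewrite mulrDr scalerAr.
Qed.
Lemma reg_act1 (a : B) : a * 1 = a. Proof. exact: mulr1. Qed.
Lemma reg_actM (m a b : B) : m * (a * b) = m * a * b. Proof. exact: mulrA. Qed.

Definition rreg : rmod B := RMod reg_bilin reg_act1 reg_actM.

Lemma rcomul_act (a b : B) : comul B (a * b) = @diag_act rreg rreg (comul B a) b.
Proof. exact: comulM. Qed.
Definition rcomul : rhom rreg (rtens rreg rreg) :=
  @RHom _ _ rreg (rtens rreg rreg) (comul B) rcomul_act.

Lemma rcounit_act (a b : B) : counit B (a * b) = unit_act (counit B a) b.
Proof. exact: rmorphM. Qed.
Definition rcounit : rhom rreg runit :=
  @RHom _ _ rreg runit (counit B) rcounit_act.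

(* The pushout in Mod_B of f and g, by its universal property there:           *)
(*        f                                                                    *)
(*    A -----> X                                                               *)
(*  g |        | i                                                             *)
(*    Y -----> Q                                                               *)
(*        j                                                                    *)
Definition is_pushout (A X Y Q : rmod B) (f : rhom A X) (g : rhom A Y)
    (i : rhom X Q) (j : rhom Y Q) : Prop :=
  rcomp i f =1 rcomp j g /\
  forall (T : rmod B) (u : rhom X T) (v : rhom Y T),
    rcomp u f =1 rcomp v g ->
    exists h : rhom Q T,
      [/\ rcomp h i =1 u, rcomp h j =1 v &
          forall h' : rhom Q T, rcomp h' i =1 u -> rcomp h' j =1 v -> h' =1 h].

Definition is_iso M N (f : rhom M N) : Prop :=
  exists g : rhom N M, rcomp g f =1 rid M /\ rcomp f g =1 rid N.

(* M (x) Delta : M (x) B -> (M (x) B) (x) B, associativity made explicit. *)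
Definition tens_comul M : rhom (rtens M rreg) (rtens (rtens M rreg) rreg) :=
  rcomp (rassocV M rreg rreg) (rtmap (rid M) rcomul).

(* M (x) epsilon : M (x) B -> M, the right unit constraint made explicit. *)
Definition tens_counit M : rhom (rtens M rreg) M :=
  rcomp (rrunit M) (rtmap (rid M) rcounit).

(* Right Hopf modules: right comodules over the coalgebra B in Mod_B. *)
Record hopf_module := HopfModule {
  hcar :> rmod B;
  hcoact : rhom hcar (rtens hcar rreg);
  hcoactA : rcomp (rtmap hcoact (rid rreg)) hcoact =1
            rcomp (tens_comul hcar) hcoact;
  hcoact_counit : rcomp (tens_counit hcar) hcoact =1 rid hcar
}.

Definition is_hopf_hom (Z Y : hopf_module) (h : rhom Z Y) : Prop :=
  rcomp (rtmap h (rid rreg)) (hcoact Z) =1 rcomp (hcoact Y) h.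

Section PartialComoduleAxioms.
Context (M MB : rmod B) (pi : rhom (rtens M rreg) MB) (rho : rhom M MB).

Definition GPC1 : Prop :=
  exists Meps : rhom MB M,
    rcomp Meps rho =1 rid M /\ rcomp Meps pi =1 tens_counit M.

(* The two pushouts exist in Mod_B and are unique up to a unique isomorphism,  *)
(* so that the axiom does not depend on how they are chosen:                   *)
(*   (MB_B, rhoB, piMB) is (M . B) . B with rho_M . B and pi_(M . B), and      *)
(*   (M_BB, MDelta, piMD) is M . (B . B) with M . Delta and pi_(M, Delta).     *)
Definition GPC2 : Prop :=
  exists (MB_B : rmod B) (rhoB : rhom MB MB_B) (piMB : rhom (rtens MB rreg) MB_B)
         (M_BB : rmod B) (MDelta : rhom MB M_BB)
         (piMD : rhom (rtens MB rreg) M_BB),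
    [/\ is_pushout pi (rtmap rho (rid rreg)) rhoB piMB,
        is_pushout pi (rcomp (rtmap pi (rid rreg)) (tens_comul M)) MDelta piMD &
        exists theta : rhom M_BB MB_B,
          [/\ is_iso theta,
              rcomp theta piMD =1 piMB &
              rcomp theta (rcomp MDelta rho) =1 rcomp rhoB rho]].

End PartialComoduleAxioms.

(* Right Hopf partial comodules: geometric partial comodules over the          *)
(* coalgebra B in Mod_B; pc_bullet is the object M . B.                        *)
Record hopf_partial_comodule := HopfPartialComodule {
  pc_car :> rmod B;
  pc_bullet : rmod B;
  pc_pi : rhom (rtens pc_car rreg) pc_bullet;
  pc_rho : rhom pc_car pc_bullet;
  pc_pi_surj : forall y, exists x, pc_pi x = y;
  pc_GPC1 : GPC1 pc_pi pc_rho;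
  pc_GPC2 : GPC2 pc_pi pc_rho
}.

(* rho_M o f = pi_M o (f (x) B) o delta_Z *)
Definition is_partial_hom (M : hopf_partial_comodule) (Z : hopf_module)
    (f : rhom Z M) : Prop :=
  rcomp (pc_rho M) f =1
  rcomp (pc_pi M) (rcomp (rtmap f (rid rreg)) (hcoact Z)).

(* The second condition says that h |-> p o h is a bijection from the Hopf     *)
(* module morphisms Z -> Y onto the f : Z -> M such that is_partial_hom f;     *)
(* maps being compared pointwise, this is spelled out as well-definedness,     *)
(* injectivity and surjectivity.                                               *)
Definition is_globalization (M : hopf_partial_comodule) (Y : hopf_module)
    (p : rhom Y M) : Prop :=
  [/\ is_partial_hom p,
      forall Z : hopf_module,
        [/\ forall h : rhom Z Y, is_hopf_hom h -> is_partial_hom (rcomp p h),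
            forall h h' : rhom Z Y, is_hopf_hom h -> is_hopf_hom h' ->
              rcomp p h =1 rcomp p h' -> h =1 h' &
            forall f : rhom Z M, is_partial_hom f ->
              exists h : rhom Z Y, is_hopf_hom h /\ rcomp p h =1 f] &
      is_pushout p (rcomp (rtmap p (rid rreg)) (hcoact Y))
        (pc_rho M) (pc_pi M)].

Definition globalizable (M : hopf_partial_comodule) : Prop :=
  exists (Y : hopf_module) (p : rhom Y M), is_globalization p.

End ModB.

(* Main.v *)
Require Import Defs.
From HB Require Import structures.
From mathcomp Require Import all_boot all_order all_algebra.
From mathcomp Require Import boolp classical_sets.

Set Implicit Arguments.
Unset Strict Implicit.
Unset Printing Implicit Defensive.

(** Write D : M (x) B -> (M (x) B) (x) B for M (x) Delta, which makes M (x) B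
    the cofree Hopf module on M.  The globalization of M is
      Y = { x in M (x) B | (rho (x) B) x = (pi (x) B) (D x) },
    with p : Y -> M the restriction of M (x) epsilon.

    Both rho (x) B and (pi (x) B) o D are morphisms of cofree Hopf modules,
    M (x) B -> (M . B) (x) B, so Y is an equalizer of Hopf modules.  Such
    equalizers are computed in Mod_B because - (x) B is exact over a field
    ([tmap_inj], [rtens_kerP], hence [hopf_equalizer]).  Exactness comes from
    linear pseudo-inverses ([linear_pinv]), obtained from Zorn's lemma, since
    the spaces involved may be infinite dimensional.

    By the counit law, (p (x) B) o delta_Y is the inclusion of Y in M (x) B.
    Hence a Hopf morphism h into Y is determined by p o h, and a map f : Z -> M
    comes from the Hopf morphism (f (x) B) o delta_Z, which lands in Y exactly
    because f is compatible with the partial coaction.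

    The remaining point is that M . B is the pushout of p and the inclusion of
    Y.  As pi is onto, this amounts to saying that Y is the whole graph
      { x | pi x = rho m for some m }, with then p x = m.
    [equalizer_graph] gives one inclusion, by applying (M . B) (x) epsilon to
    the equation of Y.  For the other one, [partial_graph], the isomorphism of
    GPC2 only says that the two sides of the equation of Y become equal in
    (M . B) . B.  But that object is a pushout along rho (x) B, which GPC1
    splits by means of (M . epsilon) (x) B; two vectors with the same image in
    such a pushout and the same image under the retraction are equal
    ([pushout_split_inj]), and the retraction maps both sides to x. *)

Import GRing.Theory.
Local Open Scope ring_scope.

Local Notation tensB f := (rtmap f (rid (rreg _))).

(** * Exactness of the tensor product over a field *)

Section LinearAlgebra.
Context (k : fieldType).
Implicit Types U V W T : lmodType k.

(** Linear maps are produced below by solving equations whose solution is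
    unique; uniqueness then makes any choice of solutions linear. *)
Lemma linear_of_rel V W (R : V -> W -> Prop) :
  (forall v, exists w, R v w) ->
  (forall v w w', R v w -> R v w' -> w = w') ->
  (forall c v v' w w', R v w -> R v' w' -> R (c *: v + v') (c *: w + w')) ->
  exists f : {linear V -> W}, forall v, R v (f v).
Proof.
move=> /choice[f fR] Runiq Rlin.
have flin : linear f by move=> c v v'; apply: Runiq (fR _) _; exact: Rlin.
pose F : {linear V -> W} := HB.pack f (GRing.isLinear.Build _ _ _ _ f flin).
by exists F => v; exact: fR.
Qed.

Local Open Scope classical_set_scope.

(** A subspace C maximal among those meeting S trivially is a complement: if v
    were outside C + S, the span of C and v would still meet S trivially. *)
Lemma subspace_complement V (S : set V) :
  S 0 -> (forall c x y, S x -> S y -> S (c *: x + y)) ->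
  exists C : set V, [/\ forall c x y, C x -> C y -> C (c *: x + y),
    forall x, C x -> S x -> x = 0 & forall v, exists2 s, S s & C (v - s)].
Proof.
move=> S0 Slin.
(* P also holds for the empty set, as is needed for the empty chain. *)
pose P (C : set V) := (forall c x y, C x -> C y -> C (c *: x + y)) /\
  (forall x, C x -> S x -> x = 0).
have [|C [[Clin CS] Cmax]] := @Zorn_bigcup V P.
  move=> F FP Ftot; split=> [c x y [A FA Ax] [A' FA' Ay]|x [A FA Ax]];
    last exact: (FP A FA).2.
  have [sub|sub] := Ftot _ _ FA FA'.
    by exists A' => //; apply: (FP _ FA').1 => //; exact: sub.
  by exists A => //; apply: (FP _ FA).1 => //; exact: sub.
have C0 : C 0.
  apply: contrapT => nC0; apply: (Cmax [set 0]); split.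
  - move=> x Cx; case: nC0.
    by have := Clin (-1) _ _ Cx Cx; rewrite scaleN1r addNr.
  - by move=> /(_ 0 erefl).
  - by move=> c x y -> ->; rewrite scaler0 addr0.
  - by [].
exists C; split=> // v; apply: contrapT => nv.
apply: (Cmax [set x | exists c y, C y /\ x = c *: v + y]); split.
- by move=> x Cx; exists 0, x; split; rewrite // scale0r add0r.
- move=> /(_ v) Cv; apply: nv; exists 0; rewrite // subr0; apply: Cv.
  by exists 1, 0; rewrite scale1r addr0.
- move=> c _ _ [a [y [Cy ->]]] [b [z [Cz ->]]].
  exists (c * a + b), (c *: y + z); split; first exact: Clin.
  by rewrite scalerDr scalerA scalerDl addrACA.
- move=> _ [c [y [Cy ->]]]; have [->|c0] := eqVneq c 0.
    by rewrite scale0r add0r; exact: CS.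
  move=> Sx; case: nv; exists (c^-1 *: (c *: v + y)).
    by rewrite -[_ *: _]addr0; exact: Slin.
  rewrite scalerDr scalerA mulVf// scale1r opprD addrA subrr add0r -scaleNr.
  by rewrite -[_ *: _]addr0; exact: Clin.
Qed.

Lemma subspace_projection V (S : set V) :
  S 0 -> (forall c x y, S x -> S y -> S (c *: x + y)) ->
  exists e : {linear V -> V}, (forall v, S (e v)) /\ forall s, S s -> e s = s.
Proof.
move=> S0 Slin; have [C [Clin CS VSC]] := subspace_complement S0 Slin.
have uniq v s s' : S s /\ C (v - s) -> S s' /\ C (v - s') -> s = s'.
  move=> [Ss Cs] [Ss' Cs']; apply/eqP; rewrite -subr_eq0; apply/eqP/CS.
    have := Clin (-1) _ _ Cs Cs'.
    by rewrite scaleN1r opprB addrA addrNK.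
  have := Slin (-1) _ _ Ss' Ss.
  by rewrite scaleN1r addrC.
have [||e eP] := @linear_of_rel V V (fun v s => S s /\ C (v - s)) _ uniq.
- by move=> v; have [s Ss Cs] := VSC v; exists s.
- move=> c v v' w w' [Sw Cw] [Sw' Cw']; split; first exact: Slin.
  by rewrite opprD addrACA -scalerBr; exact: Clin.
exists e; split=> [v|s Ss]; first by have [] := eP v.
apply: uniq (eP s) _; split=> //; rewrite subrr.
have [s' _ Cs'] := VSC 0.
by have := Clin (-1) _ _ Cs' Cs'; rewrite scaleN1r addNr.
Qed.

(** Tensoring with W turns an identity g q g = g into the same identity, which
    says at once that kernels and images of g are preserved; so this lemma is
    all the exactness that is needed. *)
Lemma linear_pinv V W (g : {linear V -> W}) :
  exists q : {linear W -> V}, forall v, g (q (g v)) = g v.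
Proof.
have [||e [ke eK]] := @subspace_projection V [set v | g v = 0].
- exact: linear0.
- by move=> c x y /= gx gy; rewrite linearP gx gy scaler0 addr0.
have [||r [ir rK]] := @subspace_projection W [set w | exists v, g v = w].
- by exists 0; rewrite linear0.
- by move=> c _ _ [x <-] [y <-]; exists (c *: x + y); rewrite linearP.
(* q w is the preimage under g, in the chosen complement of its kernel, of the
   projection of w to the image of g. *)
pose R w u := exists2 v, g v = r w & u = v - e v.
have [|||q qP] := @linear_of_rel W V R.
- by move=> w; have [v gv] := ir w; exists (v - e v), v.
- move=> w _ _ [v gv ->] [v' gv' ->].
  have ed : e (v - v') = v - v' by apply: eK; rewrite /= linearB gv gv' subrr.
  by rewrite -[v](subrK v') linearD ed opprD addrACA subrr add0r.
- move=> c w w' _ _ [v gv ->] [v' gv' ->]; exists (c *: v + v').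
    by rewrite !linearP gv gv'.
  by rewrite linearP opprD addrACA -scalerBr.
exists q => v; have [v' gv' ->] := qP (g v).
by rewrite linearB ke subr0 gv' rK//; exists v.
Qed.

Lemma eq_tens V W T (g h : {linear tens V W -> T}) :
  (forall v w, g (tpure v w) = h (tpure v w)) -> g =1 h.
Proof. exact: tlift_unique (linearP g) (linearP h). Qed.

Lemma eq_tens3 U V W T (g h : {linear tens (tens U V) W -> T}) :
  (forall u v w, g (tpure (tpure u v) w) = h (tpure (tpure u v) w)) -> g =1 h.
Proof.
move=> gh; apply: eq_tens => t w; move: t.
apply: (@tlift_unique k U V T (fun t => g (tpure t w))
  (fun t => h (tpure t w))).
- by move=> c x y; rewrite -linearP; congr (g _); exact: (tpure_bilin _ _).1.
- by move=> c x y; rewrite -linearP; congr (h _); exact: (tpure_bilin _ _).1.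
- by move=> u v; exact: gh.
Qed.

Lemma tmap_comp V V' V'' W W' W''
    (f' : {linear V' -> V''}) (f : {linear V -> V'})
    (g' : {linear W' -> W''}) (g : {linear W -> W'}) t :
  tmap f' g' (tmap f g t) = tmap (f' \o f) (g' \o g) t.
Proof.
move: t; apply: (@eq_tens _ _ _ (tmap f' g' \o tmap f g)) => v w /=.
by rewrite !tmap_pure.
Qed.

Lemma eq_tmap V V' W W' (f f' : {linear V -> V'}) (g g' : {linear W -> W'}) :
  f =1 f' -> g =1 g' -> tmap f g =1 tmap f' g'.
Proof.
move=> ff' gg'; apply: (@eq_tens _ _ _ (tmap f g) (tmap f' g')) => v w /=.
by rewrite !tmap_pure ff' gg'.
Qed.

Lemma tmap_id V W :
  tmap (idfun : {linear V -> V}) (idfun : {linear W -> W}) =1 id.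
Proof.
apply: (@eq_tens _ _ _ (tmap idfun idfun) idfun) => v w /=.
by rewrite tmap_pure.
Qed.

Lemma tmap_inj V V' W (f : {linear V -> V'}) :
  injective f -> injective (tmap f (idfun : {linear W -> W})).
Proof.
move=> finj; have [q fqf] := linear_pinv f.
apply: (can_inj (g := tmap q idfun)) => t.
rewrite tmap_comp -[RHS]tmap_id.
by apply: eq_tmap => // v; exact/finj/fqf.
Qed.

Lemma tpureDl V W (v v' : V) (w : W) :
  tpure (v + v') w = tpure v w + tpure v' w.
Proof. by have /= := (tpure_bilin V W).1 w 1 v v'; rewrite !scale1r. Qed.

(** [tpure v] packaged as a linear map of its second argument. *)
Definition tpurel V W (v : V) : W -> tens V W := tpure v.
HB.instance Definition _ V W (v : V) :=
  GRing.isLinear.Build k W (tens V W) *:%R (@tpurel V W v)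
    ((tpure_bilin V W).2 v).

End LinearAlgebra.
Arguments tpurel {k V} W v _ /.

(** * Kernels and factorizations in Mod_B *)

Section ModB.
Context (k : fieldType) (B : bialgebra k).
Implicit Types M N P X Y Z : rmod B.

Lemma rfactor_inj X Y Z (i : rhom Y X) (f : rhom Z X) :
  injective i -> (forall z, exists y, i y = f z) ->
  exists h : rhom Z Y, rcomp i h =1 f.
Proof.
move=> inji /(@linear_of_rel k Z Y (fun z y => i y = f z))[||h hP].
- by move=> z y y' <- /inji.
- by move=> c z z' y y' iy iy'; rewrite !linearP iy iy'.
have hact z b : h (ract z b) = ract (h z) b.
  by apply: inji; rewrite hP !rfun_act hP.
by exists (RHom hact).
Qed.

Lemma rfactor_surj X Y Z (q : rhom X Y) (f : rhom X Z) :
  (forall y, exists x, q x = y) -> (forall x, q x = 0 -> f x = 0) ->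
  exists h : rhom Y Z, rcomp h q =1 f.
Proof.
move=> surjq qf.
have fE x x' : q x = q x' -> f x = f x'.
  by move=> E; apply/subr0_eq; rewrite -linearB qf// linearB E subrr.
have [|||h hP] := @linear_of_rel k Y Z
  (fun y z => exists2 x, q x = y & f x = z).
- by move=> y; have [x qx] := surjq y; exists (f x), x.
- by move=> _ _ _ [x <- <-] [x' /fE <- <-].
- move=> c _ _ _ _ [x <- <-] [x' <- <-].
  by exists (c *: x + x'); rewrite linearP.
have hq x : h (q x) = f x by have [x' /fE <- <-] := hP (q x).
have hact y b : h (ract y b) = ract (h y) b.
  by have [x <-] := surjq y; rewrite -rfun_act !hq rfun_act.
by exists (RHom hact).
Qed.

Lemma ractBl M (m n : M) b : ract (m - n) b = ract m b - ract n b.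
Proof.
by have /= := (ract_bilin M).1 b (-1) n m; rewrite !scaleN1r !(addrC (- _)).
Qed.

Section Sub.
Context (M N : rmod B) (f g : rhom M N).

Definition rsub_fun (m : M) : N := f m - g m.

Lemma rsub_linear : linear rsub_fun.
Proof. by move=> c x y; rewrite /rsub_fun !linearP addrACA -scalerDr. Qed.
HB.instance Definition _ := GRing.isLinear.Build _ _ _ _ rsub_fun rsub_linear.

Lemma rsub_act m b : rsub_fun (ract m b) = ract (rsub_fun m) b.
Proof. by rewrite /rsub_fun !rfun_act ractBl. Qed.
Definition rsub : rhom M N := @RHom _ _ M N rsub_fun rsub_act.
End Sub.

Section Kernel.
Context (M N : rmod B) (g : rhom M N).

Definition kerp : {pred M} := [pred m | g m == 0].

Lemma kerp_submod : submod_closed kerp.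
Proof.
split=> [|c x y]; first by rewrite !inE linear0.
by rewrite !inE linearP => /eqP-> /eqP->; rewrite scaler0 addr0.
Qed.
HB.instance Definition _ := GRing.isSubmodClosed.Build k M kerp kerp_submod.

Record ker := Ker { ker_val :> M; ker_valP : ker_val \in kerp }.
HB.instance Definition _ := [isSub for ker_val].
HB.instance Definition _ := [Choice of ker by <:].
HB.instance Definition _ := [SubChoice_isSubLmodule of ker by <:].

Lemma ker_act_subproof (m : ker) b : ract (val m) b \in kerp.
Proof.
have /eqP gm := ker_valP m; rewrite inE rfun_act gm.
by have := bilinZl 0 0 b (ract_bilin N); rewrite !scale0r => ->.
Qed.
Definition ker_act (m : ker) b : ker := Ker (ker_act_subproof m b).

Lemma ker_act_bilin : bilin ker_act.
Proof.
split=> [b c m m'|m c b b']; apply: val_inj; rewrite !linearP /=.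
  exact: (ract_bilin M).1.
exact: (ract_bilin M).2.
Qed.
Lemma ker_act1 m : ker_act m 1 = m.
Proof. by apply: val_inj; rewrite /= ract1. Qed.
Lemma ker_actM m a b : ker_act m (a * b) = ker_act (ker_act m a) b.
Proof. by apply: val_inj; rewrite /= ractM. Qed.

Definition rker : rmod B := RMod ker_act_bilin ker_act1 ker_actM.

Lemma ker_incl_act (m : ker) b : val (ker_act m b) = ract (val m) b.
Proof. by []. Qed.
Definition rincl : rhom rker M :=
  @RHom _ _ rker M (val : {linear ker -> M}) ker_incl_act.

Lemma rincl_inj : injective rincl.
Proof. exact: val_inj. Qed.

Lemma rker0 (y : rker) : g (rincl y) = 0.
Proof. exact/eqP/(ker_valP y). Qed.

Lemma rkerP m : g m = 0 -> exists y, rincl y = m.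
Proof.
by move=> gm; have mP : m \in kerp; [rewrite inE gm|exists (Ker mP)].
Qed.

(** With g q g = g, the map 1 - q g is a projection onto the kernel of g, and
    it fixes, after tensoring with P, everything killed by g (x) P. *)
Lemma rtens_kerP P t : rtmap g (rid P) t = 0 ->
  exists s, rtmap rincl (rid P) s = t.
Proof.
move=> gt; have [q gqg] := linear_pinv g.
have [|||e eP] := @linear_of_rel k M rker (fun m y => rincl y = m - q (g m)).
- by move=> m; apply: rkerP; rewrite linearB gqg subrr.
- by move=> m y y' <- /rincl_inj.
- by move=> c m m' y y' E E'; rewrite !linearP E E' /= addrACA -scalerDr.
exists (tmap e idfun t).
transitivity (tmap rincl idfun (tmap e idfun t)
  + tmap q idfun (rtmap g (rid P) t)); first by rewrite gt linear0 addr0.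
clear gt; move: t.
apply: (@eq_tens _ _ _ _
  ((tmap rincl (idfun : {linear P -> P}) \o tmap e idfun) \+
   (tmap q idfun \o tmap g idfun)) idfun) => m p /=.
by rewrite !tmap_pure -tpureDl eP subrK.
Qed.

End Kernel.

Lemma tensB_comp M N P (g : rhom N P) (f : rhom M N) t :
  tensB g (tensB f t) = tensB (rcomp g f) t.
Proof. by rewrite /= tmap_comp; exact: eq_tmap. Qed.

Lemma eq_tensB M N (f g : rhom M N) : f =1 g -> tensB f =1 tensB g.
Proof. by move=> fg; exact: eq_tmap. Qed.

Lemma tensB_sub M N (f g : rhom M N) t :
  tensB (rsub f g) t = tensB f t - tensB g t.
Proof.
move: t.
apply: (@eq_tens _ _ _ _ (tensB (rsub f g)) (rsub (tensB f) (tensB g))) => m b.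
apply/esym/eqP; rewrite /= /rsub_fun /= !tmap_pure /= subr_eq -tpureDl.
by rewrite /rsub_fun subrK.
Qed.

(** * The cofree Hopf module M (x) B *)

Lemma tens_comul_pure M (m : M) (b : rreg B) :
  tens_comul M (tpure m b) = tassocV (tpure m (comul B b)).
Proof. by rewrite /= tmap_pure. Qed.

Lemma tens_counit_pure M (m : M) (b : rreg B) :
  tens_counit M (tpure m b) = counit B b *: m.
Proof. by rewrite /= tmap_pure trunit_pure. Qed.

Lemma tmap_tassocV (U V W U' V' W' : lmodType k) (f : {linear U -> U'})
    (g : {linear V -> V'}) (h : {linear W -> W'}) u y :
  tmap (tmap f g) h (tassocV (tpure u y)) = tassocV (tpure (f u) (tmap g h y)).
Proof.
move: y; apply: (@eq_tens _ _ _ _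
  (tmap (tmap f g) h \o (@tassocV _ U V W \o tpurel (tens V W) u))
  (@tassocV _ U' V' W' \o (tpurel (tens V' W') (f u) \o tmap g h))) => v w /=.
by rewrite !tassocV_pure !tmap_pure /= tmap_pure tassocV_pure.
Qed.

Lemma tens_comul_nat M N (f : rhom M N) :
  rcomp (rtmap (rtmap f (rid (rreg B))) (rid (rreg B))) (tens_comul M) =1
  rcomp (tens_comul N) (rtmap f (rid (rreg B))).
Proof.
apply: eq_tens => m b /=.
by rewrite !tmap_pure /= tmap_tassocV tmap_id.
Qed.

Lemma tens_counit_nat M N (f : rhom M N) :
  rcomp f (tens_counit M) =1 rcomp (tens_counit N) (rtmap f (rid (rreg B))).
Proof.
apply: eq_tens => m b /=.
by rewrite !tmap_pure !trunit_pure linearZ.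
Qed.

(** On m (x) b both sides are m (x) - applied, up to bracketing, to one of the
    two sides of the coassociativity of Delta at b. *)
Lemma tens_comulA M :
  rcomp (rtmap (tens_comul M) (rid (rreg B))) (tens_comul M) =1
  rcomp (tens_comul (rtens M (rreg B))) (tens_comul M).
Proof.
apply: eq_tens => m b.
transitivity (tmap (@tassocV _ M B B \o tpurel (tens B B) m) idfun
  (tmap (comul B) idfun (comul B b))).
  rewrite [LHS]/= tmap_pure /=; move: (comul B b).
  apply: (@eq_tens _ _ _ _ (tmap (tens_comul M) idfun \o
      (@tassocV _ M B B \o tpurel (tens B B) m))
    (tmap (@tassocV _ M B B \o tpurel (tens B B) m) idfun \o
      tmap (comul B) idfun)).
  by move=> b1 b2 /=; rewrite /tpurel tassocV_pure !tmap_pure /= tmap_pure.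
transitivity (tassocV (tmap (tpurel B m) idfun
  (tmap idfun (comul B) (comul B b)))).
  rewrite -comulA; move: (tmap (comul B) _ _).
  apply: (@eq_tens3 _ _ _ _ _
    (tmap (@tassocV _ M B B \o tpurel (tens B B) m) idfun)
    (@tassocV _ (tens M B) B B \o
      (tmap (tpurel B m) idfun \o @tassoc _ B B B))).
  move=> a b' c /=.
  by rewrite tmap_pure /= tassoc_pure !tmap_pure !tassocV_pure.
rewrite [RHS]/= tmap_pure /=; move: (comul B b).
apply: (@eq_tens _ _ _ _ (@tassocV _ (tens M B) B B \o
    (tmap (tpurel B m) idfun \o tmap idfun (comul B)))
  (tens_comul (rtens M (rreg B)) \o (@tassocV _ M B B \o tpurel (tens B B) m))).
by move=> b1 b2 /=; rewrite /tpurel tassocV_pure !tmap_pure.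
Qed.

Lemma tens_counitr M :
  rcomp (tens_counit (rtens M (rreg B))) (tens_comul M) =1 rid _.
Proof.
apply: eq_tens => m b.
transitivity (tpure m (trunit (tmap idfun (counit B) (comul B b)))); last first.
  by rewrite comul_counitr.
rewrite [LHS]/= tmap_pure /=; move: (comul B b).
apply: (@eq_tens _ _ _ _ (tens_counit (rtens M (rreg B)) \o
    (@tassocV _ M B B \o tpurel (tens B B) m))
  (tpurel B m \o (@trunit _ B \o tmap idfun (counit B)))) => b1 b2 /=.
rewrite /tpurel tassocV_pure !tmap_pure !trunit_pure.
by rewrite (bilinZr _ _ _ (tpure_bilin _ _)).
Qed.

Lemma tens_counitl M :
  rcomp (rtmap (tens_counit M) (rid (rreg B))) (tens_comul M) =1 rid _.
Proof.
apply: eq_tens => m b.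
transitivity (tpure m (tlunit (tmap (counit B) idfun (comul B b)))); last first.
  by rewrite comul_counitl.
rewrite [LHS]/= tmap_pure /=; move: (comul B b).
apply: (@eq_tens _ _ _ _ (tmap (tens_counit M) idfun \o
    (@tassocV _ M B B \o tpurel (tens B B) m))
  (tpurel B m \o (@tlunit _ B \o tmap (counit B) idfun))) => b1 b2 /=.
rewrite /tpurel tassocV_pure !tmap_pure /= tmap_pure tlunit_pure trunit_pure.
by rewrite (bilinZr _ _ _ (tpure_bilin _ _)) (bilinZl _ _ _ (tpure_bilin _ _)).
Qed.

Definition cofree_hopf M : hopf_module B :=
  HopfModule (@tens_comulA M) (@tens_counitr M).

(** * Equalizers of Hopf modules *)

Lemma hopf_hom_comp (X Y Z : hopf_module B) (g : rhom Y Z) (f : rhom X Y) :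
  is_hopf_hom g -> is_hopf_hom f -> is_hopf_hom (rcomp g f).
Proof.
by move=> gP fP x; rewrite [LHS]/= -tensB_comp [tensB f _]fP [LHS]gP.
Qed.

Lemma hopf_hom_inj (X Y Z : hopf_module B) (i : rhom Y X) (h : rhom Z Y) :
  is_hopf_hom i -> injective i -> is_hopf_hom (rcomp i h) -> is_hopf_hom h.
Proof.
move=> iP iinj ihP z; apply: (tmap_inj iinj).
have := ihP z; rewrite /= -[tmap (i \o h) _ _](tensB_comp i h) /= => ->.
by have := iP (h z).
Qed.

(** The coaction of X maps the kernel K of f - g into the kernel of
    (f - g) (x) B, which is K (x) B; the axioms hold in K because they hold in
    X and the inclusion remains injective after tensoring. *)
Lemma hopf_equalizer (X X' : hopf_module B) (f g : rhom X X') :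
  is_hopf_hom f -> is_hopf_hom g ->
  exists (Y : hopf_module B) (i : rhom Y X),
    [/\ is_hopf_hom i, injective i & forall x, f x = g x <-> exists y, i y = x].
Proof.
move=> fP gP; pose i := rincl (rsub f g).
have iinj : injective i by exact: rincl_inj.
have iE x : f x = g x <-> exists y, i y = x.
  split=> [fg|[y <-]]; first by apply: rkerP; rewrite /= /rsub_fun fg subrr.
  exact/subr0_eq/(rker0 y).
have [|y|d dP] := rfactor_inj (i := tensB i) (f := rcomp (hcoact X) i).
- exact: tmap_inj.
- apply: rtens_kerP; rewrite tensB_sub.
  rewrite [X in X - _](fP (i y)) [X in _ - X](gP (i y)) /=.
  by rewrite ((iE _).2 (ex_intro _ y erefl)) subrr.
have dA : rcomp (tensB d) d =1 rcomp (tens_comul _) d.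
  move=> y; apply: (tmap_inj (tmap_inj iinj)).
  transitivity (tensB (hcoact X) (hcoact X (i y))).
    rewrite [LHS](tensB_comp (tensB i) d) (eq_tensB dP) -tensB_comp.
    exact: (congr1 (tensB (hcoact X)) (dP y)).
  rewrite [LHS](hcoactA (i y)); apply: esym.
  transitivity (tens_comul X (tensB i (d y)));
    first exact: (tens_comul_nat i (d y)).
  exact: (congr1 (tens_comul X) (dP y)).
have d1 : rcomp (tens_counit _) d =1 rid _.
  move=> y; apply: iinj.
  rewrite [LHS](tens_counit_nat i (d y)) -[RHS](hcoact_counit (i y)).
  exact: (congr1 (tens_counit X) (dP y)).
by exists (HopfModule dA d1), i.
Qed.

(** * Pushouts along split monomorphisms *)

Lemma rzero_act M N (m : M) b :
  (\0 : {linear M -> N}) (ract m b) = ract ((\0 : {linear M -> N}) m) b.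
Proof. by have /= := bilinZl 0 0 b (ract_bilin N); rewrite !scale0r => ->. Qed.
Definition rzero M N : rhom M N := RHom (@rzero_act M N).

(** Since s splits, Y is the direct sum of A and the kernel of r, and the
    pushout leaves the second summand untouched.  Concretely, 1 - s r vanishes
    on the image of s, so it factors through j. *)
Lemma pushout_split_inj (A X Y Q : rmod B) (f : rhom A X) (s : rhom A Y)
    (i : rhom X Q) (j : rhom Y Q) (r : rhom Y A) :
  is_pushout f s i j -> rcomp r s =1 rid A ->
  forall a b, j a = j b -> r a = r b -> a = b.
Proof.
move=> [_ univ] rs a b jab rab.
have [|h [_ hj _]] := univ Y (rzero X Y) (rsub (rid Y) (rcomp s r)).
  by move=> x; rewrite /= /rsub_fun /= [r (s x)]rs subrr.
have := hj a; rewrite /= jab [h (j b)]hj /= /rsub_fun /= rab.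
by move/addIr.
Qed.

(** * The globalization *)

Section Globalization.
Variable M : hopf_partial_comodule B.
Local Notation pi := (pc_pi M).
Local Notation rho := (pc_rho M).

(** The elements x of M (x) B that represent the partial coaction of some m
    satisfy the equation of Y.  GPC2 identifies the images of its two sides in
    (M . B) . B, and (M . epsilon) (x) B maps both of them to x. *)
Lemma partial_graph (x : rtens M (rreg B)) (m : M) :
  pi x = rho m ->
  tensB rho x = tensB pi (tens_comul M x) /\ tens_counit M x = m.
Proof.
have [e [erho epi]] := pc_GPC1 M.
have [Q [rhoB [piB [Q' [MD [piD [po [cD _] [th [_ thpi thrho]]]]]]]]]
  := pc_GPC2 M.
move=> pxm; split; last by rewrite -[LHS]epi /= pxm [LHS]erho.
have er : rcomp (tensB e) (tensB rho) =1 rid _.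
  by move=> t; rewrite [LHS]tensB_comp (eq_tensB erho) /= tmap_id.
apply: (pushout_split_inj po er).
  rewrite -[LHS](po.1 x) /= pxm -[LHS]thrho /= -pxm.
  by rewrite [MD (pi x)]cD [LHS]thpi.
by rewrite [LHS]er [RHS]tensB_comp (eq_tensB epi) [RHS]tens_counitl.
Qed.

Lemma equalizer_graph (x : rtens M (rreg B)) :
  tensB rho x = tensB pi (tens_comul M x) -> rho (tens_counit M x) = pi x.
Proof.
move=> E; transitivity (tens_counit _ (tensB rho x)).
  exact: (tens_counit_nat rho x).
rewrite E; transitivity (pi (tens_counit _ (tens_comul M x))).
  exact/esym/(tens_counit_nat pi).
exact: (congr1 pi (tens_counitr x)).
Qed.

End Globalization.

End ModB.

Theorem theorem4p5 (k : fieldType) (B : bialgebra k)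
  (M : hopf_partial_comodule B) : globalizable M.
Proof.
pose b := rreg B; pose pi := pc_pi M; pose rho := pc_rho M.
have rP : @is_hopf_hom _ _
    (cofree_hopf M) (cofree_hopf (pc_bullet M)) (tensB rho).
  exact: tens_comul_nat.
have dP : @is_hopf_hom _ _
    (cofree_hopf M) (cofree_hopf (rtens M b)) (tens_comul M).
  exact: tens_comulA.
have pP : @is_hopf_hom _ _
    (cofree_hopf (rtens M b)) (cofree_hopf (pc_bullet M)) (tensB pi).
  exact: tens_comul_nat.
have [Y [i [iP iinj iE]]] := hopf_equalizer rP (hopf_hom_comp pP dP).
pose p := rcomp (tens_counit M) i.
(* The counit law makes (p (x) B) o delta_Y the inclusion i. *)
have pB y : tensB p (hcoact Y y) = i y.
  by rewrite -tensB_comp [tensB i _]iP [LHS]tens_counitl.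
have pE (Z : hopf_module B) (h : rhom Z Y) : is_hopf_hom h ->
    forall z, tensB (rcomp p h) (hcoact Z z) = i (h z).
  move=> hP z; rewrite -tensB_comp -[RHS](pB (h z)).
  exact: (congr1 (tensB p) (hP z)).
have pZ (Z : hopf_module B) (h : rhom Z Y) :
    is_hopf_hom h -> is_partial_hom (rcomp p h).
  move=> hP z; apply: etrans (congr1 pi (esym (pE Z h hP z))).
  by apply: equalizer_graph; apply/iE; exists (h z).
exists Y, p; split.
- move=> y; apply: etrans (congr1 pi (esym (pB y))).
  by apply: equalizer_graph; apply/iE; exists y.
- move=> Z; split=> [h hP|h h' hP hP' phh' z|f fP]; first exact: pZ.
    by apply: iinj; rewrite -(pE Z h)// -(pE Z h')// (eq_tensB phh').
  have fH : @is_hopf_hom _ _ Z (cofree_hopf M) (rcomp (tensB f) (hcoact Z)).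
    move=> z; rewrite -[LHS](tensB_comp (tensB f) (hcoact Z)).
    apply: etrans (congr1 (tensB (tensB f)) (hcoactA z)) _.
    exact: (tens_comul_nat f).
  have [z|h hf] := rfactor_inj (i := i) (f := rcomp (tensB f) (hcoact Z)) iinj.
    apply/iE.
    rewrite [LHS](tensB_comp rho f) (eq_tensB fP).
    rewrite -(tensB_comp pi (rcomp (tensB f) (hcoact Z))).
    exact: (congr1 (tensB pi) (fH z)).
  exists h; split.
    apply: (hopf_hom_inj iP iinj) => z.
    apply: etrans (eq_tensB hf _) _; apply: etrans (fH z) _.
    exact: (congr1 (tens_comul M) (esym (hf z))).
  move=> z; rewrite [LHS](congr1 (tens_counit M) (hf z)).
  by rewrite -[RHS](congr1 f (hcoact_counit z)) [RHS]tens_counit_nat.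
have graphE x m : pi x = rho m -> exists2 y, i y = x & p y = m.
  move=> /partial_graph[/iE[y iy] xm]; exists y => //.
  by rewrite -xm -iy.
split=> [y|T u v uv].
  rewrite [RHS](congr1 pi (pB y)).
  by apply: equalizer_graph; apply/iE; exists y.
have uvE x m : pi x = rho m -> v x = u m.
  move=> /graphE[y <- <-]; rewrite [RHS](uv y).
  exact: (congr1 v (esym (pB y))).
have [|h hpi] := rfactor_surj (f := v) (@pc_pi_surj _ _ M).
  by move=> x pix; rewrite (uvE x 0) ?linear0.
exists h; split=> // [m|h' _ h'v w].
  have [x pix] := pc_pi_surj (rho m).
  by rewrite /= -pix [LHS]hpi; exact: uvE.
have [x <-] := pc_pi_surj w.
by rewrite [LHS]h'v -[LHS]hpi.
Qed.
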